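(* Let $m,n,r\in\mathbb{N}$, let $\alpha_1,\dots,\alpha_r$ be positive real numbers with $\sum_{i=1}^r\alpha_i<n$, and put $\alpha_{r+1}=n-\sum_{i=1}^r\alpha_i>0$. For $x>0$ define $$R(x)=\frac{\Gamma_m\bigl(xn+\frac{m+1}{2}\bigr)}{\prod_{i=1}^{r+1}\Gamma_m\bigl(x\alpha_i+\frac{m+1}{2}\bigr)}.$$ Let $\ell\in\mathbb{N}$ and let $(\lambda_1,\dots,\lambda_\ell)\in(0,\infty)^\ell$ be such that $\sum_{k=1}^\ell\lambda_k=1$. 1. For $(x_1,\dots,x_\ell)\in(0,\infty)^\ell$, we have $$R\Bigl(\sum_{k=1}^\ell\lambda_kx_k\Bigr)\le\prod_{k=1}^\ell[R(x_k)]^{\lambda_k},$$ where the equality holds if and only if $x_1=x_2=\dots=x_\ell$. 2. For $(x_1,\dots,x_\ell)\in(0,\infty)^\ell$, we have $$\prod_{k=1}^\ell R(x_k)<R\Bigl(\sum_{k=1}^\ell x_k\Bigr).$$ 3. For $\ell=3$ and $(x_1,x_2,x_3)\in(0,\infty)^3$, if $x_1\le x_3$, then $$R(x_1+x_2)\,R(x_3)\le R(x_1)\,R(x_2+x_3),$$ where the equality holds if and only if $x_1=x_3$.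
   Context: $\mathbb{N}=\{1,2,\dots\}$. The multivariate gamma function is $$\Gamma_m(z)=\pi^{m(m-1)/4}\prod_{j=1}^m\Gamma\Bigl(z-\frac{j-1}{2}\Bigr),\qquad \Re(z)>\frac{m-1}{2},$$ where $\Gamma$ is the classical gamma function.
   Formalization: Part 2 is stated only for ℓ ≥ 2, because for ℓ = 1 the printed strict inequality would read R(x_1) < R(x_1), which is false. *)

(* Defs.v *)
From HB Require Import structures.
From mathcomp Require Import all_boot all_order all_algebra.
From mathcomp Require Import all_classical all_reals all_analysis.
Set Implicit Arguments.
Unset Strict Implicit.
Unset Printing Implicit Defensive.
Import Order.TTheory GRing.Theory Num.Theory.
Import numFieldNormedType.Exports.
Local Open Scope classical_set_scope.
Local Open Scope ring_scope.

(* Euler's integral of the second kind; it is meaningful for 0 < z. When the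
   integral diverges (z <= 0), [Rintegral] returns the junk value 0. *)
Definition Gamma (R : realType) (z : R) : R :=
  \int[@lebesgue_measure R]_(t in `]0, +oo[) (t `^ (z - 1) * expR (- t)).

(* Restricted to real arguments; meaningful for (m - 1) / 2 < z. *)
Definition multiGamma (R : realType) (m : nat) (z : R) : R :=
  pi `^ (m%:R * (m%:R - 1) / 4)
  * \prod_(1 <= j < m.+1) Gamma (z - (j%:R - 1) / 2).

(* The tuple (alpha_1, ..., alpha_r) completed by
   alpha_{r+1} = n - \sum_i alpha_i at the index [ord_max]. *)
Definition alpha_ext (R : realType) (n r : nat) (alpha : 'I_r -> R)
    (i : 'I_r.+1) : R :=
  if unlift ord_max i is Some j then alpha j
  else n%:R - \sum_(k < r) alpha k.

Definition gammaRatio (R : realType) (m n r : nat) (alpha : 'I_r -> R)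
    (x : R) : R :=
  multiGamma m (x * n%:R + (m%:R + 1) / 2)
  / \prod_(i < r.+1) multiGamma m (x * alpha_ext n alpha i + (m%:R + 1) / 2).

(* Main.v *)
Require Import Defs.
From HB Require Import structures.
From mathcomp Require Import all_boot all_order all_algebra.
From mathcomp Require Import all_classical all_reals all_analysis.
From mathcomp Require Import measurable_realfun ring lra.
Set Implicit Arguments.
Unset Strict Implicit.
Unset Printing Implicit Defensive.
Import Order.TTheory GRing.Theory Num.Theory.
Import numFieldNormedType.Exports.
Local Open Scope ring_scope.

(** Up to a constant factor, R is the product over b = 1, 3/2, ..., (m + 1)/2 of
    Gamma(n x + b) / prod_i Gamma(alpha_i x + b), so strict log-convexity of R
    means that, for each b, the Jensen gap G(u) of x |-> ln Gamma(u x + b) is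
    strictly superadditive in u. Iterating Gamma(z + 1) = z Gamma(z), with
    log-convexity of Gamma controlling the remainder, gives
    G(u) = sum_(i >= 0) H((b + i) / u), where H(y) is the Jensen gap of
    x |-> - ln(x + y), a decreasing function of y. Let y be the k-th smallest
    (k = 0, 1, ...) among the points (b + i) / u and (b + j) / v. As 1 <= b,
    comparing counts shows (b + k) / (u + v) <= y; hence G(u) + G(v) < G(u + v).
    Part 3 is strict convexity of ln R. Part 2 follows from convexity on
    [0, +oo[ and ln R(0) <= 0, which holds because pi^(k/2) Gamma(1 + k/2) >= 1. *)

(** * Euler's integral on [1, +oo[ *)

Section GammaIntegral.
Local Open Scope classical_set_scope.
Local Open Scope ring_scope.
Variable R : realType.
Local Notation mu := (@lebesgue_measure R).
Implicit Types a b c p r t z w : R.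

Lemma cvgy_expRN r : 0 < r -> expR (- (r * t)) @[t --> +oo] --> (0 : R).
Proof.
move=> r0.
apply: (@cvg_comp _ _ _ (fun t => r * t) (fun t => expR (- t)) _ (pinfty_nbhs R));
  last exact: cvgr_expR.
exact: gt0_cvgMry.
Qed.

Lemma is_derive_expRN r t :
  is_derive t 1 (fun t => expR (- (r * t))) (- r * expR (- (r * t))).
Proof.
by apply: is_derive_eq; rewrite /GRing.scale /=; ring.
Qed.

Lemma integral_expRN r a : 0 < r ->
  (\int[mu]_(t in `[a, +oo[) (expR (- (r * t)))%:E = (expR (- (r * a)) / r)%:E)%E.
Proof.
move=> r0.
have d t : is_derive t 1 (fun t => - (expR (- (r * t)) / r)) (expR (- (r * t))).
  have := is_derive_expRN r t => dt.
  apply: is_derive_eq.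
  rewrite /GRing.scale /=.
  by field; lra.
have dc t : {for t, continuous (fun t => - (expR (- (r * t)) / r))}.
  by apply: differentiable_continuous; apply/derivable1_diffP; apply: ex_derive.
rewrite (@ge0_continuous_FTC2y _ _ (fun t => - (expR (- (r * t)) / r)) _ 0).
- by rewrite sub0e EFinN oppeK.
- by move=> x _; exact: expR_ge0.
- apply: derivable_within_continuous => t _.
  by have := is_derive_expRN r t => dt; apply: ex_derive.
- rewrite -oppr0 -[in X in _ --> X](mul0r r^-1); apply: cvgN; apply: cvgMr_tmp.
  exact: cvgy_expRN.
- by move=> x _; apply: ex_derive.
- by apply: cvg_at_right_filter; exact: dc.
- by move=> x _; rewrite derive1E; have [_ ->] := d x.
Qed.

Lemma measurable_fun_expRN r (D : set R) :
  measurable_fun D (fun t => expR (- (r * t))).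
Proof.
apply: measurable_funTS; apply: measurableT_comp; first exact: measurable_expR.
by apply: measurableT_comp => //; exact: measurable_funM.
Qed.

Lemma integrable_expRN r : 0 < r ->
  mu.-integrable `]0, +oo[ (fun t => (expR (- (r * t)))%:E).
Proof.
move=> r0; apply/integrableP; split.
  by apply/measurable_EFinP; exact: measurable_fun_expRN.
under eq_integral do rewrite gee0_abs ?lee_fin ?expR_ge0//.
rewrite integral_itv_obnd_cbnd ?integral_expRN ?ltry//.
by apply/measurable_EFinP; exact: measurable_fun_expRN.
Qed.

Lemma measurable_fun_Gamma z (D : set R) :
  measurable_fun D (fun t => t `^ (z - 1) * expR (- t)).
Proof.
apply: measurable_funM.
  by apply: measurable_funTS; exact: measurable_powR.
apply: measurable_funTS; apply: measurableT_comp; first exact: measurable_expR.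
exact: measurable_funN.
Qed.

(** The bound [ln s < s] at [s = t / q] gives [p * (ln t - ln q) <= p * (t / q)]. The rate 1/2
    leaves a decaying exponential after multiplication by [expR (- t)]. *)
Lemma powR_le_expR p : 0 <= p ->
  exists2 C : R, 0 < C & forall t, 0 <= t -> t `^ p <= C * expR (t / 2).
Proof.
(* This choice gives [p / q <= 1 / 2] and keeps [q] positive at [p = 0]. *)
move=> p0; pose q := 2 * (p + 1).
have q0 : 0 < q by rewrite /q; lra.
(* The summand 1 bounds the value at [t = 0], [p = 0], where the power is 1 by convention. *)
exists (expR (p * ln q) + 1) => [|t]; first by rewrite addr_gt0 ?expR_gt0.
rewrite le_eqVlt => /predU1P[<-|t0].
  rewrite mul0r expR0 mulr1.
  have [->|pn0] := eqVneq p 0; first by rewrite powRr0 lerDr expR_ge0.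
  by rewrite powR0// addr_ge0// expR_ge0.
apply: (@le_trans _ _ (expR (p * ln q) * expR (t / 2))); last first.
  by rewrite ler_pM2r ?expR_gt0// lerDl.
rewrite /powR gt_eqF// -expRD ler_expR.
have : ln (t / q) < t / q by apply: ln_sublinear; rewrite divr_gt0.
rewrite ln_div ?posrE// => h.
have : p * (ln t - ln q) <= p * (t / q) by rewrite ler_wpM2l// ltW.
have : p * (t / q) <= t / 2.
  rewrite mulrA ler_pdivrMr// /q; nra.
lra.
Qed.

Lemma integrable_Gamma z : 1 <= z ->
  mu.-integrable `]0, +oo[ (fun t => (t `^ (z - 1) * expR (- t))%:E).
Proof.
move=> z1.
have [C C0 hC] := @powR_le_expR (z - 1) ltac:(lra).
have iE : mu.-integrable `]0, +oo[ (fun t => (expR (- (2^-1 * t)))%:E).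
  by apply: integrable_expRN; lra.
apply: (le_integrable _ _ _ (integrableZl _ C iE)) => //.
  by apply/measurable_EFinP; exact: measurable_fun_Gamma.
move=> t /=; rewrite in_itv/= andbT => t0.
rewrite lee_fin ger0_norm; last by rewrite mulr_ge0 ?powR_ge0 ?expR_ge0.
rewrite ger0_norm; last by rewrite mulr_ge0 ?expR_ge0 ?ltW.
apply: (@le_trans _ _ (C * expR (t / 2) * expR (- t))).
  by rewrite ler_pM2r ?expR_gt0// hC// ltW.
rewrite -mulrA -expRD ler_pM2l// ler_expR; lra.
Qed.

(** On [1, +oo[ the power of [t] is at least 1, so [Gamma z] is at least the integral of
    [expR (- t)] there, namely [expR (- 1)]. *)
Lemma Gamma_gt0 z : 1 <= z -> 0 < Gamma z.
Proof.
move=> z1; rewrite /Gamma.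
have i := integrable_Gamma z1.
apply: (@lt_le_trans _ _ (expR (- (1 * 1)))); first exact: expR_gt0.
rewrite -lee_fin /Rintegral fineK; last exact: integrable_fin_num.
rewrite -[expR _]divr1 -integral_expRN//.
apply: (@le_trans _ _ (\int[mu]_(t in `[1%R, +oo[) (t `^ (z - 1) * expR (- t))%:E)%E).
  apply: ge0_le_integral => //.
  - by apply/measurable_EFinP; exact: measurable_fun_expRN.
  - by apply/measurable_EFinP; exact: measurable_fun_Gamma.
  - move=> t /=; rewrite in_itv/= andbT => t1; rewrite lee_fin mul1r.
    rewrite ler_peMl ?expR_ge0//.
    by rewrite -[leLHS](powRr0 t) ler_powR// subr_ge0.
apply: ge0_subset_integral => //.
- by apply/measurable_EFinP; exact: measurable_fun_Gamma.
- by move=> t _; rewrite lee_fin mulr_ge0 ?powR_ge0 ?expR_ge0.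
- by apply: subset_itvr; rewrite bnd_simp.
Qed.

Lemma Gamma1 : Gamma (1 : R) = 1.
Proof.
have -> : Gamma 1 = \int[mu]_(t in `]0, +oo[) expR (- (1 * t)) :> R.
  by apply: eq_Rintegral => t _; rewrite subrr powRr0 !mul1r.
rewrite /Rintegral integral_itv_obnd_cbnd; last first.
  by apply/measurable_EFinP; exact: measurable_fun_expRN.
by rewrite integral_expRN// mulr0 oppr0 expR0 divr1.
Qed.

(** * The functional equation of Gamma *)

Lemma powR_cvg_at_right0 p : 0 <= p -> t `^ p @[t --> 0^'+] --> (0 : R) `^ p.
Proof.
rewrite le_eqVlt => /predU1P[<-|p0].
  rewrite powRr0; under eq_fun do rewrite powRr0.
  exact: cvg_cst.
rewrite powR0 ?gt_eqF//; exact: powR_cvg0.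
Qed.

Lemma Gamma_rec z : 1 <= z -> Gamma (z + 1) = z * Gamma z.
Proof.
move=> z1.
have [C C0 hC] := @powR_le_expR (z - 1) ltac:(lra).
have [B B0 hB] := @powR_le_expR z ltac:(lra).
pose e r t : R := expR (- (r * t)).
pose g z t : R := t `^ (z - 1) * expR (- t).
(* f is the integrand of Gamma (z + 1) - z Gamma z plus an exponential that
   makes it nonnegative, as the fundamental theorem on [0, +oo[ requires. *)
pose f t : R := g (z + 1) t - z * g z t + z * C * e 2^-1 t.
pose F t : R := - (t `^ z * expR (- t)) - 2 * z * C * e 2^-1 t.
have ig x : 1 <= x -> mu.-integrable `]0, +oo[ (EFin \o g x).
  by move=> x1; exact: integrable_Gamma.
have ie : mu.-integrable `]0, +oo[ (EFin \o e 2^-1) by apply: integrable_expRN; lra.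
have izg : mu.-integrable `]0, +oo[ (EFin \o (fun t => z * g z t)).
  exact: integrableZl (ig _ z1).
have izC : mu.-integrable `]0, +oo[ (EFin \o (fun t => z * C * e 2^-1 t)).
  exact: integrableZl ie.
have igz : mu.-integrable `]0, +oo[ (EFin \o (fun t => g (z + 1) t - z * g z t)).
  by have i1 := ig (z + 1) ltac:(lra); exact: (integrableB _ i1 izg).
have intf : mu.-integrable `]0, +oo[ (EFin \o f) by exact: (integrableD _ igz izC).
have expd (t : R) : expR (t / 2) * expR (- t) = e 2^-1 t.
  by rewrite -expRD; congr expR; lra.
have ce r : continuous (e r).
  move=> t; apply: differentiable_continuous; apply/derivable1_diffP.
  by have := is_derive_expRN r t => dt; apply: ex_derive.
have cN : continuous (fun t : R => expR (- t)).
  move=> t; apply: differentiable_continuous; apply/derivable1_diffP.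
  exact: ex_derive.
have dF t : 0 < t -> is_derive t 1 F (f t).
  move=> t0; have := is_derive1_powR z t0 => d1.
  have := is_derive_expRN 2^-1 t => d2.
  apply: is_derive_eq; rewrite /GRing.scale /f /g /e addrK /=.
  by field.
have df t : 0 < t -> derivable f t 1.
  move=> t0; have := is_derive1_powR (z - 1) t0 => d1.
  have := is_derive1_powR (z + 1 - 1) t0 => d3.
  have := is_derive_expRN 2^-1 t => d2.
  exact: ex_derive.
have f0 t : 0 <= t -> 0 <= f t.
  move=> t0; rewrite /f -addrA addr_ge0//.
    by rewrite /g mulr_ge0 ?powR_ge0 ?expR_ge0.
  rewrite addrC subr_ge0 -mulrA ler_pM2l; last lra.
  by rewrite -expd// mulrA ler_pM2r ?expR_gt0// hC.
have cf : {within `[0, +oo[, continuous f}.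
  apply/continuous_within_itvcyP; split.
    move=> t; rewrite in_itv/= andbT => t0.
    by apply: differentiable_continuous; apply/derivable1_diffP; exact: df.
  apply: cvgD; [apply: cvgB|].
  - apply: cvgM; first by apply: powR_cvg_at_right0; lra.
    by apply: cvg_at_right_filter; exact: cN.
  - apply: cvgMl_tmp; apply: cvgM; first by apply: powR_cvg_at_right0; lra.
    by apply: cvg_at_right_filter; exact: cN.
  - by apply: cvgMl_tmp; apply: cvg_at_right_filter; exact: ce.
have F0 : F t @[t --> 0^'+] --> F 0.
  apply: cvgB.
    apply: cvgN; apply: cvgM; first by apply: powR_cvg_at_right0; lra.
    by apply: cvg_at_right_filter; exact: cN.
  by apply: cvgMl_tmp; apply: cvg_at_right_filter; exact: ce.
have Fy : F t @[t --> +oo] --> (0 : R).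
  have ey : e 2^-1 t @[t --> +oo] --> (0 : R) by apply: cvgy_expRN; lra.
  rewrite -[in X in _ --> X](subrr (0 : R)); apply: cvgB; last first.
    by rewrite -(mulr0 (2 * z * C)); exact: cvgMl_tmp.
  rewrite -oppr0; apply: cvgN.
  apply: (@squeeze_cvgr _ _ _ _ (fun=> 0) (fun t => B * e 2^-1 t)).
  - apply: filterS (nbhs_pinfty_ge (num_real 0)) => t t0.
    rewrite mulr_ge0 ?powR_ge0 ?expR_ge0//=.
    by rewrite -expd mulrA ler_pM2r ?expR_gt0// hB.
  - exact: cvg_cst.
  - by rewrite -(mulr0 B); exact: cvgMl_tmp.
have Ff : {in `]0, +oo[, derive1 F =1 f}.
  move=> t; rewrite in_itv/= andbT => t0; rewrite derive1E.
  exact: (@derive_val _ _ _ _ _ _ _ (@dF t t0)).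
have dF' t : 0 < t -> derivable F t 1 by move=> t0; have [] := dF t t0.
have := Rintegral_ge0_continuous_FTC2y f0 cf Fy dF' F0 Ff.
rewrite -Rintegral_itv_obnd_cbnd// RintegralD// RintegralB//; last by apply: ig; lra.
rewrite RintegralZl//; last exact: ig.
rewrite RintegralZl//.
(* The correction thus integrates to [2 * z * C], which is exactly [- F 0], so it cancels. *)
have -> : \int[mu]_(t in `]0, +oo[) e 2^-1 t = 2.
  rewrite /Rintegral integral_itv_obnd_cbnd; last first.
    by apply/measurable_EFinP; exact: measurable_fun_expRN.
  by rewrite integral_expRN ?invr_gt0// mulr0 oppr0 expR0 mul1r invrK.
rewrite -/(Gamma _) -/(Gamma _) /F powR0; last by rewrite gt_eqF//; lra.
rewrite /e mulr0 oppr0 expR0; move: (Gamma _) (Gamma _) => G1 G2; lra.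
Qed.

(** * Log-convexity of Gamma *)

Lemma expR_convex a b c : 0 <= a <= 1 ->
  expR (a * b + (1 - a) * c) <= a * expR b + (1 - a) * expR c.
Proof.
move=> /andP[a0 a1].
by have := convex_expR (Itv01 a0 a1) b c; rewrite !convRE.
Qed.

(* L is ln Gamma on [1, +oo[; as a variable, it keeps conversion from unfolding
   the integrals. *)
Variable L : R -> R.
Hypothesis expR_L : forall z, 1 <= z -> expR (L z) = Gamma z.

(** Hölder's inequality, obtained by integrating the weighted arithmetic-geometric mean inequality
    between the two integrands, each normalised to have integral 1. *)
Lemma Gamma_le_geometric_mean a b s : 1 <= a -> 1 <= b -> 0 <= s <= 1 ->
  Gamma (s * a + (1 - s) * b) <= expR (s * L a + (1 - s) * L b).
Proof.
move=> a1 b1 s01.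
have c1 : 1 <= s * a + (1 - s) * b by nra.
have EA := expR_L a1; have EB := expR_L b1.
move: (L a) (L b) EA EB => A B EA EB.
pose g z t : R := t `^ (z - 1) * expR (- t).
have ig x : 1 <= x -> mu.-integrable `]0, +oo[ (EFin \o g x).
  by move=> x1; exact: integrable_Gamma.
pose y := s * A + (1 - s) * B.
(* [expR (- A)] and [expR (- B)] are the normalising factors; the two integrals then add up to
   [expR y * (s + (1 - s))]. *)
pose ca := expR y * s * expR (- A).
pose cb := expR y * (1 - s) * expR (- B).
have pw t : 0 < t -> g (s * a + (1 - s) * b) t <= ca * g a t + cb * g b t.
  move=> t0; rewrite /g !mulrA -mulrDl ler_pM2r ?expR_gt0//.
  rewrite /powR (gt_eqF t0) /ca /cb -!mulrA -!expRD -mulrDr.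
  have -> : (s * a + (1 - s) * b - 1) * ln t
      = y + (s * (- A + (a - 1) * ln t) + (1 - s) * (- B + (b - 1) * ln t)).
    by rewrite /y; ring.
  by rewrite [expR (y + _)]expRD ler_pM2l ?expR_gt0// expR_convex.
have ia : mu.-integrable `]0, +oo[ (EFin \o (fun t => ca * g a t)).
  exact: integrableZl (ig _ a1).
have ib : mu.-integrable `]0, +oo[ (EFin \o (fun t => cb * g b t)).
  exact: integrableZl (ig _ b1).
have le_int : Gamma (s * a + (1 - s) * b)
    <= \int[mu]_(t in `]0, +oo[) (ca * g a t + cb * g b t).
  apply: le_Rintegral => //; first exact: ig.
    exact: (integrableD _ ia ib).
  by move=> t; rewrite /= in_itv/= andbT; exact: pw.
rewrite (le_trans le_int)// RintegralD//.
rewrite RintegralZl//; last exact: ig.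
rewrite RintegralZl//; last exact: ig.
rewrite -/(Gamma _) -/(Gamma _) -EA -EB /ca /cb !expRN.
by rewrite !divfK ?gt_eqF ?expR_gt0// -mulrDr subrKC mulr1.
Qed.

Lemma lnGamma_convex a b c : 1 <= a -> a < b -> b < c ->
  (c - a) * L b <= (c - b) * L a + (b - a) * L c.
Proof.
move=> a1 ab bc.
have b1 : 1 <= b by lra.
have c1 : 1 <= c by lra.
have ca : 0 < c - a by lra.
have s01 : 0 <= (c - b) / (c - a) <= 1.
  by rewrite divr_ge0 ?ler_pdivrMr//=; lra.
have := Gamma_le_geometric_mean a1 c1 s01.
have -> : (c - b) / (c - a) * a + (1 - (c - b) / (c - a)) * c = b by field; lra.
rewrite -expR_L// ler_expR.
have -> : (c - b) * L a + (b - a) * L c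
    = (c - a) * ((c - b) / (c - a) * L a + (1 - (c - b) / (c - a)) * L c).
  by field; lra.
by rewrite ler_pM2l.
Qed.

Lemma lnGamma_rec z : 1 <= z -> L (z + 1) = ln z + L z.
Proof.
move=> z1; apply: expR_inj; rewrite expRD lnK ?posrE; last lra.
by rewrite !expR_L ?Gamma_rec//; lra.
Qed.

Lemma lnGamma1 : L 1 = 0.
Proof. by apply: expR_inj; rewrite expR_L// Gamma1 expR0. Qed.

End GammaIntegral.

(** * Superadditivity of the Jensen gap *)

Section JensenGap.
Variable R : realType.
Implicit Types (x y z u v b c : R) (M N : nat) (f g : R -> R).

Variable L : R -> R.
Hypothesis L_rec : forall z, 1 <= z -> L (z + 1) = ln z + L z.
Hypothesis L_convex : forall a b c, 1 <= a -> a < b -> b < c ->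
  (c - a) * L b <= (c - b) * L a + (b - a) * L c.

(** By convexity the slope on [w, z] lies between those of the unit chords on [w - 1, w] and
    [z, z + 1], which the recurrence evaluates to [ln (w - 1)] and [ln z]. *)
Lemma L_slope z w : 2 <= w -> w < z ->
  (z - w) * ln (w - 1) <= L z - L w <= (z - w) * ln z.
Proof.
move=> w2 wz.
have lo := @L_convex (w - 1) w z ltac:(lra) ltac:(lra) wz.
have up := @L_convex w z (z + 1) ltac:(lra) wz ltac:(lra).
have e1 := @L_rec (w - 1) ltac:(lra).
have e2 := @L_rec z ltac:(lra).
rewrite subrK in e1.
have e1' : L (w - 1) = L w - ln (w - 1) by lra.
rewrite e1' in lo; rewrite e2 in up.
by apply/andP; split; lra.
Qed.

(** All chord slopes on [c, c + W] lie between [ln (c - 1)] and [ln (c + W)]. Hence [L] is affine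
    there up to an error that vanishes as [c] grows. *)
Lemma L_diff_bound c W z w :
  2 <= c -> c <= z <= c + W -> c <= w <= c + W ->
  `|L z - L w - (z - w) * ln (c - 1)|
    <= W * (ln (c + W) - ln (c - 1)).
Proof.
move=> c2.
wlog wz : z w / w <= z.
  move=> h hz hw; case/orP: (le_total w z) => wz; first exact: h.
  have -> : L z - L w - (z - w) * ln (c - 1) = - (L w - L z - (w - z) * ln (c - 1)).
    by ring.
  by rewrite normrN; exact: h.
move=> /andP[cz zW] /andP[cw wW].
have lncW : ln (c - 1) <= ln (c + W) by rewrite ler_ln ?posrE; lra.
move: wz; rewrite le_eqVlt => /predU1P[->|wz].
  by rewrite !subrr mul0r subr0 normr0 mulr_ge0; lra.
have /andP[lo up] := L_slope (le_trans c2 cw) wz.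
have l1 : ln (c - 1) <= ln (w - 1) by rewrite ler_ln ?posrE; lra.
have l2 : ln z <= ln (c + W) by rewrite ler_ln ?posrE; lra.
have h1 : (z - w) * ln (c - 1) <= (z - w) * ln (w - 1) by rewrite ler_wpM2l//; lra.
have h2 : (z - w) * ln z <= (z - w) * ln (c + W) by rewrite ler_wpM2l//; lra.
have h3 : (z - w) * (ln (c + W) - ln (c - 1)) <= W * (ln (c + W) - ln (c - 1)).
  by rewrite ler_wpM2r; lra.
rewrite ger0_norm; lra.
Qed.

Definition jgap l (lam xs : 'I_l -> R) f : R :=
  \sum_(k < l) lam k * f (xs k) - f (\sum_(k < l) lam k * xs k).

(* Each induction step drops the last term of the sequence whose last term is
   dominated by the last S k. *)
Lemma merge_sum (P Q S : nat -> R) (e : R) :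
  (forall i, P i <= S i) -> (forall j, Q j <= S j) ->
  (forall i j, P i <= S (i + j).+1 \/ Q j <= S (i + j).+1) ->
  P 0%N + e <= S 0%N -> Q 0%N + e <= S 0%N ->
  forall M N, (0 < M + N)%N ->
  \sum_(i < M) P i + \sum_(j < N) Q j + e <= \sum_(k < M + N) S k.
Proof.
move=> PS QS PQS P0 Q0.
have sum_gap (T : nat -> R) M : (forall i, T i <= S i) -> T 0%N + e <= S 0%N ->
    \sum_(i < M.+1) T i + e <= \sum_(i < M.+1) S i.
  by move=> TS T0; rewrite !big_ord_recl addrAC lerD// ler_sum.
elim=> [|M ihM] N; first by case: N => // N _; rewrite big_ord0 add0r sum_gap.
elim: N => [|N ihN] _; first by rewrite big_ord0 addr0 addn0 sum_gap.
rewrite addSn addnS [leRHS]big_ord_recr /=.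
have [PS'|QS'] := PQS M N.
  have h := ihM N.+1 ltac:(by rewrite addnS).
  by rewrite addnS in h; rewrite [X in X + _ + _]big_ord_recr /=; lra.
have h := ihN (ltn0Sn _).
by rewrite addSn in h; rewrite [X in _ + X + _]big_ord_recr /=; lra.
Qed.

(** The right side is the tangent line at [X] of the strictly concave function on the left. *)
Lemma ln_shift_lt x X y y' : 0 <= x -> 0 <= X -> 0 < y -> y < y' -> x != X ->
  ln (x + y) - ln (x + y')
    < ln (X + y) - ln (X + y') + (y' - y) / ((X + y') * (X + y)) * (x - X).
Proof.
move=> x0 X0 y0 yy' xX.
(* ln q <= q - 1 for the ratio q of (x + y) / (x + y') to its value at X *)
pose q := (x + y) * (X + y') / ((x + y') * (X + y)).
have d0 : 0 < (x + y') * (X + y) by rewrite mulr_gt0; lra.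
have q0 : 0 < q by rewrite divr_gt0// mulr_gt0; lra.
have : ln (1 + (q - 1)) <= q - 1 by apply: le_ln1Dx; lra.
rewrite subrKC /q ln_div ?posrE//; last by rewrite mulr_gt0; lra.
rewrite !lnM ?posrE; [|lra..].
(* [q - 1] is the linear term of the tangent minus a positive multiple of a square. *)
have : (x + y) * (X + y') / ((x + y') * (X + y)) - 1
  = (y' - y) / ((X + y') * (X + y)) * (x - X)
    - (y' - y) * (x - X) ^+ 2 / ((X + y') * (X + y) * (x + y')).
  by field; repeat split; lra.
have : 0 < (y' - y) * (x - X) ^+ 2 / ((X + y') * (X + y) * (x + y')).
  apply: divr_gt0; last by rewrite !mulr_gt0//; lra.
  by apply: mulr_gt0; [lra|rewrite exprn_even_gt0//= subr_eq0].
lra.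
Qed.

(** * Jensen gaps for a fixed family of weights and points *)

Section Family.
Variables (l : nat) (lam xs : 'I_l -> R).
Hypothesis lam_gt0 : forall k, 0 < lam k.
Hypothesis lam_sum1 : \sum_(k < l) lam k = 1.
Hypothesis xs_ge0 : forall k, 0 <= xs k.

Local Notation gap := (jgap lam xs).
Local Notation X := (\sum_(k < l) lam k * xs k).

Lemma jgap_eq f g : (forall x, 0 <= x -> f x = g x) -> gap f = gap g.
Proof.
move=> fg; rewrite /jgap fg; last first.
  by apply: sumr_ge0 => k _; rewrite mulr_ge0// ltW.
by congr (_ - _); apply: eq_bigr => k _; rewrite fg.
Qed.

Lemma jgapD f g : gap (fun x => f x + g x) = gap f + gap g.
Proof.
rewrite /jgap; under eq_bigr do rewrite mulrDr.
by rewrite big_split /=; ring.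
Qed.

Lemma jgapN f : gap (fun x => - f x) = - gap f.
Proof.
rewrite /jgap; under eq_bigr do rewrite mulrN.
by rewrite sumrN; ring.
Qed.

Lemma jgap_cst c : gap (fun=> c) = 0.
Proof. by rewrite /jgap -mulr_suml lam_sum1 mul1r subrr. Qed.

Lemma jgap_sum (I : Type) (s : seq I) (F : I -> R -> R) :
  gap (fun x => \sum_(i <- s) F i x) = \sum_(i <- s) gap (F i).
Proof.
elim: s => [|i s ih].
  rewrite big_nil -[RHS](jgap_cst 0); apply: jgap_eq => x _.
  by rewrite big_nil.
by rewrite big_cons -ih -jgapD; apply: jgap_eq => x _; rewrite big_cons.
Qed.

(** The weighted deviations from the mean sum to 0, so a linear term of any slope [c] can be
    subtracted. A slope close to that of [f] then makes each summand easy to estimate. *)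
Lemma jgapE f c : gap f = \sum_(k < l) lam k * (f (xs k) - f X - c * (xs k - X)).
Proof.
transitivity (\sum_(k < l) (lam k * f (xs k) - lam k * f X - c * (lam k * xs k)
   + c * (lam k * X))); last by apply: eq_bigr => k _; ring.
rewrite big_split /= big_split /= big_split /= !sumrN -!mulr_sumr -!mulr_suml.
by rewrite lam_sum1 /jgap; ring.
Qed.

(** The function H of the overview. *)
Definition lngap y := - gap (fun x => ln (x + y)).

Lemma wmean_ge0 : 0 <= X.
Proof. by apply: sumr_ge0 => k _; rewrite mulr_ge0// ltW. Qed.

(** The recurrence splits off [ln (u * x + b) = ln u + ln (x + b / u)], and the constant [ln u] has
    zero gap. *)
Lemma jgap_L_rec u b : 0 < u -> 1 <= b ->
  gap (fun x => L (u * x + b))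
  = gap (fun x => L (u * x + (b + 1))) + lngap (b / u).
Proof.
move=> u0 b1.
rewrite /lngap -jgapN -jgapD -[LHS]addr0 -(jgap_cst (ln u)) -jgapD.
apply: jgap_eq => x x0.
have ux : 0 <= u * x by rewrite mulr_ge0// ltW.
have bu : 0 < b / u by rewrite divr_gt0//; lra.
rewrite addrA L_rec; last lra.
have -> : u * x + b = u * (x + b / u) by field; lra.
rewrite lnM ?posrE//; last lra.
lra.
Qed.

Lemma jgap_L_split u b M : 0 < u -> 1 <= b ->
  gap (fun x => L (u * x + b))
  = gap (fun x => L (u * x + (b + M%:R)))
    + \sum_(i < M) lngap ((b + i%:R) / u).
Proof.
move=> u0 b1; elim: M => [|M ->].
  by rewrite big_ord0 !addr0.
have bM : 1 <= b + M%:R by rewrite (le_trans b1)// lerDl.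
rewrite jgap_L_rec// big_ord_recr /= -addrA -natr1 addrA.
by rewrite [in RHS]addrC -addrA; congr (_ + _); rewrite ?addrA // addrC.
Qed.

(** The remainder of the series: far out [L] is nearly affine on the range of the arguments, and
    gaps ignore affine functions. *)
Lemma jgap_L_bound u b : 0 < u -> 1 <= b ->
  exists2 D : R, 0 <= D & forall M, (0 < M)%N ->
    `|gap (fun x => L (u * x + (b + M%:R)))| <= D / M%:R.
Proof.
move=> u0 b1.
(* A length bounding every [u * xs k] and their mean, so all arguments lie in [c, c + W]. *)
pose W := u * \sum_(k < l) xs k.
have xW k : u * xs k <= W.
  rewrite ler_pM2l// (bigD1 k)//= lerDl; exact: sumr_ge0.
have W0 : 0 <= W by apply: mulr_ge0; [exact: ltW|exact: sumr_ge0].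
have XW : u * X <= W.
  rewrite mulr_sumr (@le_trans _ _ (\sum_(k < l) lam k * W))//.
    by apply: ler_sum => k _; rewrite mulrCA ler_pM2l.
  by rewrite -mulr_suml lam_sum1 mul1r.
exists (W * (W + 1)) => [|M M0]; first by rewrite mulr_ge0//; lra.
have M1 : 1 <= M%:R :> R by rewrite ler1n.
pose c := b + M%:R.
have c2 : 2 <= c by rewrite /c; lra.
rewrite (@jgapE _ (u * ln (c - 1))).
apply: (@le_trans _ _ (W * (ln (c + W) - ln (c - 1)))).
  rewrite (le_trans (ler_norm_sum _ _ _))//.
  rewrite -[leRHS]mul1r -[X in _ <= X * _]lam_sum1 mulr_suml ler_sum// => k _.
  rewrite normrM gtr0_norm// ler_pM2l//.
  rewrite (_ : _ - _ = L (u * xs k + c) - L (u * X + c)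
      - ((u * xs k + c) - (u * X + c)) * ln (c - 1)); last by rewrite /c; ring.
  have ux : 0 <= u * xs k by rewrite mulr_ge0// ltW.
  have uX : 0 <= u * X by rewrite mulr_ge0 ?wmean_ge0// ltW.
  by have xWk := xW k; apply: L_diff_bound => //; lra.
rewrite -mulrA ler_wpM2l// -ln_div ?posrE; [|lra..].
(* Since [1 <= b], also [M%:R <= c - 1], which yields the rate 1/M. *)
have -> : (c + W) / (c - 1) = 1 + (W + 1) / (c - 1) by field; lra.
apply: (@le_trans _ _ ((W + 1) / (c - 1))).
  by apply: le_ln1Dx; rewrite (lt_le_trans (ltrN10 _))// divr_ge0; lra.
by rewrite ler_wpM2l ?lef_pV2 ?posrE; rewrite /c; lra.
Qed.

Hypothesis xs_ncst : exists k, xs k != X.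

(** Subtracting the tangent at the mean from [ln (x + y') - ln (x + y)] makes every summand of the
    gap nonnegative, and zero only for a point equal to the mean. *)
Lemma lngap_lt y y' : 0 < y -> y < y' -> lngap y' < lngap y.
Proof.
move=> y0 yy'; rewrite /lngap ltrN2 -subr_gt0.
pose c := (y' - y) / ((X + y') * (X + y)).
rewrite -jgapN -jgapD (@jgapE _ (- c)).
have h k : 0 <= lam k * (ln (xs k + y') - ln (xs k + y)
    - (ln (X + y') - ln (X + y)) - - c * (xs k - X)) ?= iff (xs k == X).
  split; last first.
    have [->|ne] := eqVneq (xs k) X; first by rewrite !subrr mulr0 subrr mulr0 eqxx.
    apply/negbTE; rewrite lt_eqF// mulr_gt0//.
    by have := ln_shift_lt (xs_ge0 k) wmean_ge0 y0 yy' ne; rewrite -/c; lra.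
  have [->|ne] := eqVneq (xs k) X; first by rewrite !subrr mulr0 subrr mulr0.
  rewrite mulr_ge0 ?ltW//.
  by have := ln_shift_lt (xs_ge0 k) wmean_ge0 y0 yy' ne; rewrite -/c; lra.
have [k0 nk0] := xs_ncst.
rewrite (bigD1 k0)//= ltr_pwDl//.
  by rewrite lt_neqAle (h k0).2 nk0 (h k0).1.
by apply: sumr_ge0 => k _; exact: (h k).1.
Qed.

Lemma lngap_le y y' : 0 < y -> y <= y' -> lngap y' <= lngap y.
Proof.
move=> y0; rewrite le_eqVlt => /predU1P[->//|yy'].
exact/ltW/lngap_lt.
Qed.

Lemma jgap_L_superadditive b u v : 1 <= b -> 0 < u -> 0 < v ->
  gap (fun x => L (u * x + b)) + gap (fun x => L (v * x + b))
  < gap (fun x => L ((u + v) * x + b)).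
Proof.
move=> b1 u0 v0.
have uv0 : 0 < u + v by lra.
have b0 : 0 < b by lra.
have bi0 i : 0 < b + i%:R by rewrite ltr_wpDr.
pose P i := lngap ((b + i%:R) / u).
pose Q i := lngap ((b + i%:R) / v).
pose S i := lngap ((b + i%:R) / (u + v)).
have PS i : P i < S i.
  apply: lngap_lt; first by rewrite divr_gt0.
  by rewrite ltr_pM2l// ltf_pV2 ?posrE//; lra.
have QS i : Q i < S i.
  apply: lngap_lt; first by rewrite divr_gt0.
  by rewrite ltr_pM2l// ltf_pV2 ?posrE//; lra.
(* The mediant of (b + i) / u and (b + j) / v is (2 b + i + j) / (u + v); since
     1 <= b, it is at least (b + i + j + 1) / (u + v). *)
have PQS i j : P i <= S (i + j).+1 \/ Q j <= S (i + j).+1.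
  pose s := (b + (i + j).+1%:R) / (u + v).
  have s0 : 0 < s by rewrite divr_gt0.
  have sE : s * u + s * v = b + (i%:R + j%:R + 1).
    by rewrite -mulrDr divfK ?gt_eqF// -natr1 natrD.
  case: (leP s ((b + i%:R) / u)) => h; [left|right]; apply: lngap_le => //.
  move: h; rewrite ltr_pdivrMr// ler_pdivlMr// -/s; lra.
(* A surplus that does not depend on the truncation, so strictness survives the limit. *)
pose e := Num.min (S 0%N - P 0%N) (S 0%N - Q 0%N).
have e0 : 0 < e by rewrite lt_min !subr_gt0 PS QS.
have P0 : P 0%N + e <= S 0%N by rewrite addrC -lerBrDr ge_min lexx.
have Q0 : Q 0%N + e <= S 0%N by rewrite addrC -lerBrDr ge_min lexx orbT.
have mrg := merge_sum (fun i => ltW (PS i)) (fun i => ltW (QS i)) PQS P0 Q0.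
have [D1 D1p h1] := jgap_L_bound u0 b1.
have [D2 D2p h2] := jgap_L_bound v0 b1.
have [D3 D3p h3] := jgap_L_bound uv0 b1.
pose D := D1 + D2 + D3.
(* Large enough for the three remainders together to stay below [e]; the series are cut after [M],
   [M] and [M + M] terms. *)
pose M := (Num.bound (D / e)).+1.
have M0 : 0 < M%:R :> R by rewrite ltr0n.
have DM : D / M%:R < e.
  rewrite ltr_pdivrMr// mulrC -ltr_pdivrMr//.
  apply: (lt_trans (archi_boundP _)).
    by apply: divr_ge0; [rewrite /D; lra|exact: ltW].
  by rewrite ltr_nat.
have := mrg M M isT.
have MM : (0 < M + M)%N by [].
have := h1 M isT; have := h2 M isT; have := h3 _ MM.
rewrite (jgap_L_split M u0 b1) (jgap_L_split M v0 b1).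
rewrite (jgap_L_split (M + M) uv0 b1) -/P -/Q -/S.
have : D3 / (M + M)%:R <= D3 / M%:R.
  by rewrite ler_wpM2l// lef_pV2 ?posrE// ?ltr0n// ler_nat leq_addr.
rewrite !ler_norml.
have : D / M%:R = D1 / M%:R + D2 / M%:R + D3 / M%:R by rewrite /D !mulrDl.
lra.
Qed.

End Family.

(** Indexing by [k.+2] guarantees two terms; a single term would give equality. *)
Lemma sum_lt_superadditive (G : R -> R) k (a : 'I_k.+2 -> R) :
  (forall u v, 0 < u -> 0 < v -> G u + G v < G (u + v)) ->
  (forall i, 0 < a i) ->
  \sum_(i < k.+2) G (a i) < G (\sum_(i < k.+2) a i).
Proof.
move=> Gs; elim: k a => [|k ih] a a0.
  by rewrite !big_ord_recl !big_ord0 !addr0; exact: Gs.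
rewrite big_ord_recl [in ltRHS]big_ord_recl.
apply: (@lt_trans _ _ (G (a ord0) + G (\sum_(i < k.+2) a (lift ord0 i)))).
  by rewrite ltrD2l; apply: ih.
by apply: Gs => //; rewrite big_ord_recl ltr_wpDr ?sumr_ge0// => i _; exact: ltW.
Qed.

End JensenGap.

(** * The gamma ratio *)

Section LogRatio.
Variables (R : realType) (L : R -> R).
Hypothesis L_rec : forall z, 1 <= z -> L (z + 1) = ln z + L z.
Hypothesis L_convex : forall a b c, 1 <= a -> a < b -> b < c ->
  (c - a) * L b <= (c - b) * L a + (b - a) * L c.
Hypothesis L_1 : L 1 = 0.

(** Induction in steps of two: by the recurrence each step adds [ln pi + ln (1 + k / 2)], which is
    nonnegative. *)
Lemma L_half_ge0 k : 0 <= k%:R / 2 * ln (pi : R) + L (1 + k%:R / 2).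
Proof.
have ln2 : 0 <= ln (2 : R) by apply: ln_ge0; lra.
have ln2pi : ln 2 <= ln (pi : R).
  by rewrite ler_ln ?posrE ?pi_gt0 ?pi_ge2.
(* k = 1 uses convexity at the points 3/2 < 2 < 3. *)
elim/ltn_ind: k => -[|[|k]] ih.
- by rewrite !mul0r add0r addr0 L_1.
- have L2 : L (1 + 1) = 0 by rewrite L_rec// ln1 L_1 addr0.
  have L3 : L (2 + 1) = ln 2 by rewrite L_rec ?L2 ?addr0//; lra.
  have := @L_convex (1 + 1 / 2) (1 + 1) (2 + 1) ltac:(lra) ltac:(lra) ltac:(lra).
  by rewrite L2 L3; lra.
have := ih k (leqnSn _).
have k0 : 0 <= k%:R :> R by [].
have -> : k.+2%:R = k%:R + 2 :> R by rewrite -addn2 natrD.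
have -> : 1 + (k%:R + 2) / 2 = (1 + k%:R / 2) + 1 :> R by field.
rewrite L_rec; last lra.
have : 0 <= ln (1 + k%:R / 2 : R) by apply: ln_ge0; lra.
lra.
Qed.

Variable m : nat.
Hypothesis m_gt0 : (0 < m)%N.

(** The logarithm of [multiGamma m] at [u * x + (m + 1) / 2], with [k = m - j]. The power of pi is
    spread over the factors so that each summand is nonnegative at [x = 0]. *)
Definition lnMultiGamma u x :=
  \sum_(k < m) (k%:R / 2 * ln pi + L (u * x + (1 + k%:R / 2))).

Variables (r : nat) (a : 'I_r.+2 -> R).
Hypothesis a_gt0 : forall i, 0 < a i.

Definition lnRatio x :=
  lnMultiGamma (\sum_i a i) x - \sum_i lnMultiGamma (a i) x.

(** At 0 every [lnMultiGamma] has the same value [c >= 0], and one subtracted copy cancels the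
    leading one. *)
Lemma lnRatio0_le0 : lnRatio 0 <= 0.
Proof.
rewrite /lnRatio; pose c := \sum_(k < m) (k%:R / 2 * ln pi + L (1 + k%:R / 2)).
have lnM0 u : lnMultiGamma u 0 = c.
  by apply: eq_bigr => k _; rewrite mulr0 add0r.
have c0 : 0 <= c by apply: sumr_ge0 => k _; exact: L_half_ge0.
rewrite lnM0 big_ord_recl lnM0 opprD addNKr oppr_le0.
by apply: sumr_ge0 => i _; rewrite lnM0.
Qed.

(** The gap is linear in the function, so the claim becomes strict superadditivity of [G], a sum of
    [m] strictly superadditive functions. *)
Lemma jgap_lnRatio_gt0 l (lam xs : 'I_l -> R) :
  (forall k, 0 < lam k) -> \sum_(k < l) lam k = 1 -> (forall k, 0 <= xs k) ->
  (exists k, xs k != \sum_(j < l) lam j * xs j) -> 0 < jgap lam xs lnRatio.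
Proof.
move=> lam0 lam1 xs0 ncst.
pose G u := \sum_(k < m) jgap lam xs (fun x => L (u * x + (1 + k%:R / 2))).
have gapM u : jgap lam xs (lnMultiGamma u) = G u.
  rewrite jgap_sum//; apply: eq_bigr => k _.
  by rewrite jgapD// jgap_cst// add0r.
have -> : jgap lam xs lnRatio = G (\sum_i a i) - \sum_i G (a i).
  rewrite [LHS](jgapD lam xs (lnMultiGamma _)
    (fun x => - \sum_i lnMultiGamma (a i) x)) gapM jgapN jgap_sum//; congr (_ - _).
  by apply: eq_bigr => i _; rewrite gapM.
rewrite subr_gt0; apply: sum_lt_superadditive => // u v u0 v0.
rewrite /G -big_split/=; apply: ltr_sum => [|k _].
  by apply/hasP; exists (Ordinal m_gt0); rewrite ?mem_index_enum.
by apply: jgap_L_superadditive => //; rewrite lerDl.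
Qed.

Lemma lnRatio_strict_convex x y z : 0 <= x -> x < y -> y < z ->
  (z - x) * lnRatio y < (z - y) * lnRatio x + (y - x) * lnRatio z.
Proof.
move=> x0 xy yz; have zx : 0 < z - x by lra.
pose lam (k : 'I_2) := if k == ord0 then (z - y) / (z - x) else (y - x) / (z - x).
pose xs (k : 'I_2) := if k == ord0 then x else z.
have sum2 (f : 'I_2 -> R) : \sum_(k < 2) f k = f ord0 + f (lift ord0 ord0).
  by rewrite !big_ord_recl big_ord0 addr0.
have Xy : \sum_(k < 2) lam k * xs k = y by rewrite sum2 /lam /xs /=; field; lra.
have : 0 < jgap lam xs lnRatio.
  apply: jgap_lnRatio_gt0.
  - by move=> k; rewrite /lam; case: ifP => _; apply: divr_gt0; lra.
  - by rewrite sum2 /lam /=; field; lra.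
  - by move=> k; rewrite /xs; case: ifP => _; lra.
  - by exists ord0; rewrite Xy /xs /= lt_eqF.
rewrite /jgap Xy sum2 /lam /xs /= subr_gt0 => h.
have -> : (z - y) * lnRatio x + (y - x) * lnRatio z
    = (z - x) * ((z - y) / (z - x) * lnRatio x + (y - x) / (z - x) * lnRatio z).
  by field; lra.
by rewrite ltr_pM2l.
Qed.

(** Strict convexity at [x] and at [y] inside [0, x + y], added together, leaves only [lnRatio 0],
    which is at most 0. *)
Lemma lnRatio_superadditive x y : 0 < x -> 0 < y ->
  lnRatio x + lnRatio y < lnRatio (x + y).
Proof.
move=> x0 y0; have xy : 0 < x + y by lra.
have hx := @lnRatio_strict_convex 0 x (x + y) ltac:(lra) ltac:(lra) ltac:(lra).
have hy := @lnRatio_strict_convex 0 y (x + y) ltac:(lra) ltac:(lra) ltac:(lra).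
have h0 := lnRatio0_le0.
have : (x + y) * lnRatio 0 <= 0 by rewrite pmulr_rle0.
rewrite -(ltr_pM2l xy); lra.
Qed.

Hypothesis expR_L : forall z, 1 <= z -> expR (L z) = Gamma z.

Lemma multiGammaE u x : 0 <= u * x ->
  multiGamma m (u * x + (m%:R + 1) / 2) = expR (lnMultiGamma u x).
Proof.
move=> ux; rewrite /multiGamma /lnMultiGamma big_split/= expRD; congr (_ * _).
  rewrite /powR (gt_eqF (pi_gt0 R)) -mulr_suml; congr (expR (_ * _)).
  elim: m => [|j ih]; first by rewrite big_ord0 !mul0r.
  by rewrite big_ord_recr/= -ih -natr1; field.
(* The reversal realises [j = m - k]. *)
rewrite expR_sum big_add1/= big_mkord (reindex_inj rev_ord_inj)/=.
apply: eq_bigr => k _; rewrite expR_L; last first.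
  by have : 0 <= k%:R :> R by []; lra.
by congr Gamma; rewrite subnSK// natrB ?(ltnW (ltn_ord k))//; field.
Qed.

End LogRatio.

(** * From the gamma ratio to its logarithm *)

Section GammaRatio.
Variables (R : realType) (m n r : nat) (alpha : 'I_r -> R).

Lemma alpha_ext_gt0 : (forall i, 0 < alpha i) -> \sum_(i < r) alpha i < n%:R ->
  forall i, 0 < alpha_ext n alpha i.
Proof.
by move=> a0 an i; rewrite /alpha_ext; case: unlift => [j//|]; rewrite subr_gt0.
Qed.

Lemma sum_alpha_ext : \sum_i alpha_ext n alpha i = n%:R.
Proof.
rewrite big_ord_recr/= /alpha_ext unlift_none.
rewrite (eq_bigr alpha) ?subrKC// => i _.
have -> : widen_ord (leqnSn r) i = lift ord_max i.
  by apply: val_inj; exact/esym/lift_max.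
by rewrite liftK.
Qed.

End GammaRatio.

Lemma gammaRatioE (R : realType) (L : R -> R) (m n r : nat) (alpha : 'I_r.+1 -> R) x :
  (forall z, 1 <= z -> expR (L z) = Gamma z) ->
  (forall i, 0 < alpha i) -> \sum_(i < r.+1) alpha i < n%:R -> 0 <= x ->
  gammaRatio m n alpha x = expR (lnRatio L m (alpha_ext n alpha) x).
Proof.
move=> expR_L a0 an x0; rewrite /lnRatio sum_alpha_ext /gammaRatio expRB.
rewrite (mulrC x) (multiGammaE _ expR_L) ?mulr_ge0//.
congr (_ / _); rewrite expR_sum; apply: eq_bigr => i _.
by rewrite (mulrC x) (multiGammaE _ expR_L)// mulr_ge0// ltW// alpha_ext_gt0.
Qed.

Theorem theorem4p1 (R : realType) (m n r : nat)
    (hm : (0 < m)%N) (hn : (0 < n)%N) (hr : (0 < r)%N)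
    (alpha : 'I_r -> R) (halpha : forall i, 0 < alpha i)
    (hsum : \sum_(i < r) alpha i < n%:R)
    (l : nat) (hl : (0 < l)%N)
    (lambda : 'I_l -> R) (hlambda : forall k, 0 < lambda k)
    (hlambda1 : \sum_(k < l) lambda k = 1) :
  let Rf := gammaRatio m n alpha in
  [/\ (forall x : 'I_l -> R, (forall k, 0 < x k) ->
         Rf (\sum_(k < l) lambda k * x k)
           <= \prod_(k < l) (Rf (x k) `^ lambda k)
         /\ (Rf (\sum_(k < l) lambda k * x k)
               = \prod_(k < l) (Rf (x k) `^ lambda k)
             <-> forall i j, x i = x j)),
      ((1 < l)%N -> forall x : 'I_l -> R, (forall k, 0 < x k) ->
         \prod_(k < l) Rf (x k) < Rf (\sum_(k < l) x k))
    & (forall x1 x2 x3 : R, 0 < x1 -> 0 < x2 -> 0 < x3 -> x1 <= x3 ->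
         Rf (x1 + x2) * Rf x3 <= Rf x1 * Rf (x2 + x3)
         /\ (Rf (x1 + x2) * Rf x3 = Rf x1 * Rf (x2 + x3) <-> x1 = x3))].
Proof.
(* As [r] is positive, the completed tuple has at least two entries, as strict superadditivity
   requires. *)
case: r hr alpha halpha hsum => [hr|r' _] alpha halpha hsum Rf.
  by rewrite ltnn in hr.
have [L expR_L] : exists L : R -> R, forall z, 1 <= z -> expR (L z) = Gamma z.
  by exists (fun z => ln (Gamma z)) => z z1; rewrite lnK// posrE Gamma_gt0.
have L_rec := lnGamma_rec expR_L.
have L_convex := lnGamma_convex expR_L.
have L_1 := lnGamma1 expR_L.
have a0 := alpha_ext_gt0 halpha hsum.
pose f := lnRatio L m (alpha_ext n alpha).
have RfE x : 0 <= x -> Rf x = expR (f x).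
  by move=> x0; exact: gammaRatioE.
split.
- move=> x x0.
  pose X := \sum_(k < l) lambda k * x k.
  have X0 : 0 <= X by apply: sumr_ge0 => k _; rewrite mulr_ge0 ?ltW.
  have prodE : \prod_(k < l) (Rf (x k) `^ lambda k)
      = expR (\sum_(k < l) lambda k * f (x k)).
    rewrite expR_sum; apply: eq_bigr => k _.
    by rewrite RfE ?ltW// -expRM mulrC.
  rewrite prodE RfE// -/X ler_expR.
  (* Either some point differs from the mean and the gap is positive, or all points equal the mean
     and both sides agree. *)
  have [ncst|cst] := pselect (exists k, x k != X).
    have := jgap_lnRatio_gt0 L_rec L_convex hm a0 hlambda hlambda1
      (fun k => ltW (x0 k)) ncst.
    rewrite /jgap subr_gt0 -/f -/X => lt_f; split; first exact: ltW.
    split=> [/expR_inj eq_f|eq_x]; first by rewrite eq_f ltxx in lt_f.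
    case: ncst => k /eqP[]; rewrite /X.
    under eq_bigr do rewrite (eq_x _ k).
    by rewrite -mulr_suml hlambda1 mul1r.
  have xX k : x k = X by apply/eqP/negPn/negP => nk; apply: cst; exists k.
  have -> : \sum_(k < l) lambda k * f (x k) = f X.
    under eq_bigr do rewrite xX.
    by rewrite -mulr_suml hlambda1 mul1r.
  by split=> //; split=> // _ i j; rewrite !xX.
- case: l {hl lambda hlambda hlambda1} => [//|[//|l]] _ x x0.
  have s0 : 0 <= \sum_(k < l.+2) x k by apply: sumr_ge0 => k _; exact: ltW.
  under eq_bigr do rewrite RfE ?ltW//.
  rewrite RfE// -expR_sum ltr_expR; apply: sum_lt_superadditive => // u v.
  exact: lnRatio_superadditive.
- move=> x1 x2 x3 x10 x20 x30; rewrite !RfE; [|lra..].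
  rewrite -!expRD le_eqVlt => /predU1P[<-|x13].
    by rewrite addrC (addrC x2).
  (* [x1 + x2] and [x3] are interior to [x1, x2 + x3] and have the same sum as its endpoints, so the
     two convexity inequalities add up to the claim. *)
  have h1 := @lnRatio_strict_convex _ _ L_rec L_convex _ hm _ _ a0
    x1 (x1 + x2) (x2 + x3) ltac:(lra) ltac:(lra) ltac:(lra).
  have h2 := @lnRatio_strict_convex _ _ L_rec L_convex _ hm _ _ a0
    x1 x3 (x2 + x3) ltac:(lra) ltac:(lra) ltac:(lra).
  have c0 : 0 < x2 + x3 - x1 by lra.
  have lt_f : f (x1 + x2) + f x3 < f x1 + f (x2 + x3).
    by rewrite -(ltr_pM2l c0) /f; lra.
  split; first by rewrite ler_expR ltW.
  by split=> [/expR_inj eq_f|x1x3]; [rewrite eq_f ltxx in lt_f|lra].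
Qed.
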